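(* Let $f_i:\mathbb T\to\mathbb T$ and $h_{ij}:\mathbb T\times\mathbb T\to\mathbb R$, $i,j=1,\dots,N$, be twice continuously differentiable, and for $\alpha=(\alpha_{ij})_{i,j=1}^N$ with $\alpha_{ij}\in\mathbb R$ let $\mathcal F$ be the self-consistent transfer operator with uncoupled maps $f_i$ and interaction functions $\alpha_{ij}h_{ij}$, and $G_\alpha:\mathbb T^N\to\mathbb T^N$ the associated map (defined in the context). Let $\boldsymbol x\in\mathbb T^N$ be an attracting $k$-periodic point for $\boldsymbol f=f_1\times\dots\times f_N:\mathbb T^N\to\mathbb T^N$. Then there is $\epsilon>0$ such that if $|\alpha_{ij}|<\epsilon$ for all $i,j\in\{1,\dots,N\}$, the following hold: (1) there exists $\boldsymbol x_\alpha\in\mathbb T^N$ such that $G_\alpha^k(\boldsymbol x_\alpha)=\boldsymbol x_\alpha$; (2) denoting $X_\alpha=\{G_\alpha^\ell(\boldsymbol x_\alpha):\ell=0,\dots,k-1\}$, there are $R>0$, $\delta>0$ and $\Lambda'\in(0,1)$ such that if $\boldsymbol\mu=(\mu_1,\dots,\mu_N)\in\mathcal M_1^N$ satisfies $$|\operatorname{supp}\boldsymbol\mu|_\infty<\delta\quad\text{and}\quad\operatorname{supp}\boldsymbol\mu\subset B_R(X_\alpha),$$ then $$d_W(\mathcal F^n\boldsymbol\mu,\mathcal S_{X_\alpha})\le\mathcal O((\Lambda')^n),$$ i.e. there is a constant $C>0$ with $d_W(\mathcal F^n\boldsymbol\mu,\mathcal S_{X_\alpha})\le C(\Lambda')^n$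 for all $n\in\mathbb N$.
   Context: $\mathbb T=\mathbb R/\mathbb Z$ is the circle; $N\in\mathbb N$; $d$ denotes the distance on $\mathbb T^N$ and $B_R(X)=\{\boldsymbol y\in\mathbb T^N:\inf_{\boldsymbol x\in X}d(\boldsymbol y,\boldsymbol x)<R\}$. A point $x\in Y$ is an attracting $k$-periodic point of a map $T\in\mathcal C^1(Y)$ if $T^k(x)=x$ and there exists $\lambda\in(0,1)$ such that $\|DT^k(x)\|\le\lambda$. $\mathcal M_1$ is the set of Borel probability measures on $\mathbb T$. For a measurable map $T:\mathbb T\to\mathbb T$, its transfer operator is the push-forward $T_*\mu=\mu\circ T^{-1}$. Self-consistent operator: for $\boldsymbol\mu=(\mu_1,\dots,\mu_N)\in\mathcal M_1^N$ put $$F_{\boldsymbol\mu,i}(x)=f_i\Big(x+\sum_{j=1}^N\alpha_{ij}\int_{\mathbb T}h_{ij}(x,y)\,d\mu_j(y)\Big),\qquad \mathcal F\boldsymbol\mu=\big(F_{\boldsymbol\mu,1*}\mu_1,\dots,F_{\boldsymbol\mu,N*}\mu_N\big).$$ The map $G_\alpha$ is defined by $G_\alpha(\boldsymbol x)=\boldsymbol x'$ where $\mathcal F(\delta_{x_1},\dots,\delta_{x_N})=(\delta_{x_1'},\dots,\delta_{x_N'})$, that is, $(G_\alpha(\boldsymbol x))_i=f_i\big(x_i+\sum_j\alpha_{ij}h_{ij}(x_i,x_j)\big)$. Wasserstein distance: for $\mu,\nu\in\mathcal M_1$, $d_W(\mu,\nu)=\sup_{\varphi}\int\varphi\,d(\mu-\nu)$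 over $\varphi:\mathbb T\to\mathbb R$ with Lipschitz constant at most $1$; for $\boldsymbol\mu,\boldsymbol\nu\in\mathcal M_1^N$, $d_W(\boldsymbol\mu,\boldsymbol\nu)=\max_i d_W(\mu_i,\nu_i)$; the distance to a set is the infimum of the distances to its elements. Supports: $\operatorname{supp}\boldsymbol\mu=\operatorname{supp}\mu_1\times\dots\times\operatorname{supp}\mu_N$ (topological supports), $|\operatorname{supp}\mu_i|=\inf\{|I|: I\text{ an arc with }\operatorname{supp}\mu_i\subset I\}$ where $|I|$ is arc length, and $|\operatorname{supp}\boldsymbol\mu|_\infty=\max_i|\operatorname{supp}\mu_i|$. $\mathcal S_X=\{\boldsymbol\mu\in\mathcal M_1^N:\ \exists\boldsymbol x\in X\text{ with }\mu_i=\delta_{x_i}\ \forall i=1,\dots,N\}$. *)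

(* Defs.v *)
From HB Require Import structures.
From mathcomp Require Import all_boot all_order all_algebra.
From mathcomp Require Import generic_quotient ring_quotient.
From mathcomp Require Import all_classical all_reals all_analysis.
From mathcomp Require Import measurable_realfun.

Set Implicit Arguments.
Unset Strict Implicit.
Unset Printing Implicit Defensive.

Import Order.TTheory GRing.Theory Num.Theory.
Import numFieldNormedType.Exports.

Local Open Scope classical_set_scope.
Local Open Scope ring_scope.

Definition int_subgroup (R : realType) : zmodClosed R :=
  GRing.ZmodClosed.clone R (@Num.int_num_subdef R) _.

Definition circle (R : realType) : Type := Quotient.quot (int_subgroup R).

HB.instance Definition _ (R : realType) := GRing.Zmodule.on (circle R).

HB.instance Definition _ (R : realType) := isPointed.Build (circle R) 0.

Definition proj {R : realType} (t : R) : circle R := \pi_(circle R)%qT t.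

Lemma projD (R : realType) : {morph @proj R : s t / s + t}.
Proof. by move=> s t; exact: raddfD. Qed.

Lemma eq_proj (R : realType) (s t : R) :
  proj s = proj t <-> s - t \is a Num.int.
Proof.
have E := Quotient.idealrBE (int_subgroup R) s t; split.
  by move/eqP => e; rewrite -[_ \is a _]/(s - t \in int_subgroup R) E.
by move=> st; apply/eqP; rewrite -E.
Qed.

(* The quotient topology.  It is declared by hand because the structures of
   [quotient_topology] do not share the decidable equality of the additive
   group [circle R]. *)
Section circle_topology.
Variable R : realType.

Definition circle_open (U : set (circle R)) : Prop := open (proj @^-1` U).

Lemma circle_openT : circle_open setT.
Proof. exact: openT. Qed.

Lemma circle_openI (U V : set (circle R)) :
  circle_open U -> circle_open V -> circle_open (U `&` V).
Proof. exact: openI. Qed.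

Lemma circle_open_bigU (I : Type) (U : I -> set (circle R)) :
  (forall i, circle_open (U i)) -> circle_open (\bigcup_i U i).
Proof. by move=> oU; apply: bigcup_open => i _; exact: oU. Qed.

HB.instance Definition _ := isOpenTopological.Build (circle R)
  circle_openT circle_openI circle_open_bigU.

(* The Borel sigma-algebra. *)
HB.instance Definition _ :=
  Measurable.copy (circle R) (g_sigma_algebraType (@open (circle R))).

End circle_topology.

Section circle_metric.
Variable R : realType.
Local Open Scope ereal_scope.

Definition circle_dist (x y : circle R) : R :=
  inf [set `|t|%R | t in [set t : R | proj t = (x - y)%R]].

Definition torus (N : nat) : Type := 'rV[circle R]_N.

(* The sup distance; on ['rV[R]_N] the library norm is the sup norm. *)
Definition torus_dist (N : nat) (x y : torus N) : R :=
  \big[Num.max/0%R]_(i < N) circle_dist (x 0%R i) (y 0%R i).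

Definition torus_nbhd (N : nat) (r : R) (X : set (torus N)) : set (torus N) :=
  [set y | ereal_inf [set (torus_dist y x)%:E | x in X] < r%:E].

End circle_metric.

Section smoothness.

(* [f] is of class C^n on the set [U], to be used with [U] open and [V] of
   finite dimension: there, continuity of [x |-> 'd f x v] for each fixed [v]
   amounts to continuity of [x |-> 'd f x]. *)
Fixpoint class_C (R : realType) (V W : normedModType R) (n : nat)
    (U : set V) (f : V -> W) : Prop :=
  if n is m.+1 then
    (forall x, U x -> differentiable f x) /\
    (forall v, class_C m U (fun x => 'd f x v))
  else forall x, U x -> {for x, continuous f}.

Variable R : realType.

(* The charts of the circle are the local inverses of [proj], so [g] below is
   the expression of [f] in charts around [proj a] and [f (proj a)]. *)
Definition circle_class_C (n : nat) (f : circle R -> circle R) : Prop :=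
  forall a : R, exists U : set R, exists g : R -> R,
    [/\ open U, U a, class_C n U g &
        forall t, U t -> f (proj t) = proj (g t)].

Definition circle2_class_C (n : nat) (h : circle R -> circle R -> R) : Prop :=
  class_C n setT (fun p : R * R => h (proj p.1) (proj p.2)).

End smoothness.

Section attracting.
Variables (R : realType) (N : nat).

Definition torus_proj (v : 'rV[R]_N) : torus R N := map_mx proj v.

(* [A] is the differential of [T] at [x], read in the charts
   [v |-> x + torus_proj v] and [w |-> T x + torus_proj w]. *)
Definition torus_diff (T : torus R N -> torus R N) (x : torus R N)
    (A : 'rV[R]_N -> 'rV[R]_N) : Prop :=
  exists g : 'rV[R]_N -> 'rV[R]_N,
    [/\ g 0 = 0, differentiable g 0, 'd g 0 = A :> ('rV[R]_N -> 'rV[R]_N) &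
        \forall v \near (0 : 'rV[R]_N),
          T (x + torus_proj v) = T x + torus_proj (g v)].

Definition opnorm (A : 'rV[R]_N -> 'rV[R]_N) : \bar R :=
  ereal_sup [set `|A v|%:E | v in [set v : 'rV[R]_N | `|v| <= 1]].

Definition attracting_periodic (k : nat) (T : torus R N -> torus R N)
    (x : torus R N) : Prop :=
  [/\ (0 < k)%N, iter k T x = x &
      exists2 lambda : R, 0 < lambda < 1 &
        exists2 A, torus_diff (iter k T) x A & (opnorm A <= lambda%:E)%E].

Definition product_map (f : 'I_N -> circle R -> circle R) (x : torus R N) :
    torus R N :=
  \row_i f i (x 0 i).

End attracting.

Section self_consistent.
Variables (R : realType) (N : nat).
Variables (f : 'I_N -> circle R -> circle R)
          (h : 'I_N -> 'I_N -> circle R -> circle R -> R)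
          (alpha : 'M[R]_N).

(* In the library a measure is a function on all subsets, of which only the
   values on measurable sets are meaningful.  The operator acts on tuples of
   such set functions; on tuples of probability measures and for continuous
   [f] and [h], its values are tuples of probability measures again. *)
Definition set_function : Type := set (circle R) -> \bar R.

Definition mean_field_map (mu : 'I_N -> set_function) (i : 'I_N)
    (x : circle R) : circle R :=
  f i (x + proj (\sum_(j < N)
                   alpha i j * fine (\int[mu j]_y (h i j x y)%:E)%E)).

Definition self_consistent_op (mu : 'I_N -> set_function) :
    'I_N -> set_function :=
  fun i => pushforward (mu i) (mean_field_map mu i).

Definition coupled_map (x : torus R N) : torus R N :=
  \row_i f i (x 0 i + proj (\sum_(j < N) alpha i j * h i j (x 0 i) (x 0 j))).

Lemma self_consistent_op_dirac (x : torus R N) :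
  (forall i j y, measurable_fun setT (h i j y)) ->
  self_consistent_op (fun i => \d_(x 0 i)) =
  (fun i => \d_(coupled_map x 0 i)).
Proof.
move=> mh; apply/funext => i; apply/funext => A.
have E : mean_field_map (fun j => \d_(x 0 j)) i (x 0 i) = coupled_map x 0 i.
  rewrite /mean_field_map mxE; congr (f i (_ + proj _)); apply: eq_bigr => j _.
  rewrite integral_dirac ?diracT ?mul1e//.
  by apply/measurable_EFinP; exact: mh.
by rewrite /self_consistent_op /pushforward !diracE -E.
Qed.

End self_consistent.

Section wasserstein.
Variables (R : realType) (N : nat).
Local Open Scope ereal_scope.

Definition lipschitz1 (phi : circle R -> R) : Prop :=
  forall x y, (`|phi x - phi y| <= circle_dist x y)%R.

Definition wasserstein (mu nu : set_function R) : \bar R :=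
  ereal_sup [set \int[mu]_x (phi x)%:E - \int[nu]_x (phi x)%:E
            | phi in lipschitz1].

Definition wasserstein_max (mu nu : 'I_N -> set_function R) : \bar R :=
  \big[maxe/0]_(i < N) wasserstein (mu i) (nu i).

Definition wasserstein_set (mu : 'I_N -> set_function R)
    (S : set ('I_N -> probability (circle R) R)) : \bar R :=
  ereal_inf [set wasserstein_max mu (fun i => nu i) | nu in S].

Definition dirac_tuples (X : set (torus R N)) :
    set ('I_N -> probability (circle R) R) :=
  [set nu | exists2 x, X x &
     forall i A, measurable A -> nu i A = \d_(x 0%R i) A].

End wasserstein.

Section supports.
Variable R : realType.

Definition msupport (mu : probability (circle R) R) : set (circle R) :=
  [set x | forall U, open U -> U x -> (0 < mu U)%E].

Definition arc (a l : R) : set (circle R) := proj @` `[a, a + l].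

Definition support_length (mu : probability (circle R) R) : R :=
  inf [set l | 0 <= l <= 1 /\ exists a, msupport mu `<=` arc a l].

Variable N : nat.
Implicit Type mu : 'I_N -> probability (circle R) R.

Definition support_prod mu : set (torus R N) :=
  [set x | forall i, msupport (mu i) (x 0 i)].

Definition support_size mu : R :=
  \big[Num.max/0]_(i < N) support_length (mu i).

End supports.

(* Main.v *)
(* The linearisation of [f] along the periodic orbit is diagonal, and for each
   coordinate the product of the k derivatives has absolute value < 1.  Hence
   there are positive k-periodic weights w_{l,i} for which one step of [f_i] from
   time l to time l+1 contracts the weighted distance near the orbit by a factor
   theta < 1.  For small [alpha] one step of the coupled dynamics still contracts
   the weighted sup distance, by some Lambda < 1, and maps the boxes around the
   orbit of [x] into one another, so [G_alpha^k] has a fixed point.  Writing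
   [F^n mu] as the push-forward of [mu] by maps [Phi_n], the same estimate, with
   [h(x, y)] averaged over [mu_j], shows that [Phi_n] sends the support of [mu]
   within O(Lambda^n) of a point of [X_alpha].  Smallness of the support of [mu]
   only serves to select that point. *)

Require Import Defs.
From mathcomp Require Import all_boot all_order all_algebra.
From mathcomp Require Import all_classical all_reals all_analysis.
From mathcomp Require Import measurable_realfun ring lra.

Set Implicit Arguments.
Unset Strict Implicit.
Unset Printing Implicit Defensive.

Import Order.TTheory GRing.Theory Num.Theory.
Import numFieldNormedType.Exports.

Local Open Scope classical_set_scope.
Local Open Scope ring_scope.

(* [proj] alone is a projection of product topologies in the library. *)
Local Notation proj := Defs.proj.

(** * The metric of the circle *)

Section circle_dist.
Variable R : realType.
Implicit Types (x y z : circle R) (s t : R).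

Lemma proj0 : @proj R 0 = 0.
Proof. exact: raddf0. Qed.

Lemma projN : {morph @proj R : s / - s}.
Proof. by move=> s; exact: raddfN. Qed.

Lemma projB : {morph @proj R : s t / s - t}.
Proof. by move=> s t; exact: raddfB. Qed.

Lemma proj_surj x : exists t, proj t = x.
Proof. by exists (generic_quotient.repr x); exact: generic_quotient.reprK. Qed.

Lemma proj_half_surj x : exists2 t, proj t = x & `|t| <= 2^-1.
Proof.
have [t <-] := proj_surj x.
exists (t - (Num.floor (t + 2^-1))%:~R).
  apply/eq_proj; rewrite addrAC subrr add0r rpredN; exact: intr_int.
have /andP[] := floor_itv (t + 2^-1).
rewrite intrD => h1 h2; rewrite ler_norml; lra.
Qed.

(** Two lifts of one point differ by an integer. If that integer is nonzero, then [|s - t| >= 1],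
    and [|s| <= 1/2] forces [|t| >= 1/2]. *)
Lemma le_norm_proj s t : `|s| <= 2^-1 -> proj s = proj t -> `|s| <= `|t|.
Proof.
move=> s2 /eq_proj/intrP[m e].
have [m0|m0] := eqVneq m 0.
  by move: e; rewrite m0 => /eqP; rewrite subr_eq0 => /eqP ->.
have m1 : 1 <= `|m%:~R : R|.
  rewrite -intr_norm -[1]/(1%:~R) ler_int -gtz0_ge1; by rewrite normr_gt0.
have : `|s - t| <= `|s| + `|t| by exact: ler_normB.
by rewrite e => h; lra.
Qed.

Lemma circle_dist_le x y t : proj t = x - y -> circle_dist x y <= `|t|.
Proof.
move=> e; apply: ge_inf; last by exists t.
by exists 0 => _ [s _ <-].
Qed.

(** The infimum in [circle_dist] is attained at a lift in [[-1/2, 1/2]]; this is how distances are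
    computed below. *)
Lemma circle_dist_norm x y t :
  proj t = x - y -> `|t| <= 2^-1 -> circle_dist x y = `|t|.
Proof.
move=> e t2; apply/eqP; rewrite eq_le circle_dist_le//=.
apply: lb_le_inf; first by exists `|t|, t.
by move=> _ [s es <-]; apply: le_norm_proj => //; rewrite e.
Qed.

Lemma circle_dist_lift x y :
  exists2 t, proj t = x - y & `|t| = circle_dist x y.
Proof.
have [t et t2] := proj_half_surj (x - y).
by exists t => //; rewrite (circle_dist_norm et).
Qed.

Lemma circle_dist_half x y : circle_dist x y <= 2^-1.
Proof.
have [t et t2] := proj_half_surj (x - y).
by rewrite (circle_dist_norm et).
Qed.

Lemma circle_dist_ge0 x y : 0 <= circle_dist x y.
Proof. by have [t _ <-] := circle_dist_lift x y. Qed.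

Lemma circle_distxx x : circle_dist x x = 0.
Proof.
by rewrite (@circle_dist_norm _ _ 0) ?normr0 ?invr_ge0// proj0 subrr.
Qed.

Lemma circle_dist_eq0 x y : circle_dist x y <= 0 -> x = y.
Proof.
have [t et <-] := circle_dist_lift x y.
rewrite normr_le0 => /eqP t0; apply/eqP; rewrite -subr_eq0 -et t0.
by rewrite proj0.
Qed.

Lemma circle_distC x y : circle_dist x y = circle_dist y x.
Proof.
have [t et t2] := proj_half_surj (x - y).
rewrite (circle_dist_norm et)// (@circle_dist_norm _ _ (- t)) ?normrN//.
by rewrite projN et opprB.
Qed.

Lemma circle_dist_triangle y x z :
  circle_dist x z <= circle_dist x y + circle_dist y z.
Proof.
have [s es <-] := circle_dist_lift x y.
have [t et <-] := circle_dist_lift y z.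
apply: le_trans (ler_normD s t); apply: circle_dist_le.
by rewrite projD es et addrA subrK.
Qed.

(** Measures the effect of two different coupling terms [s] and [t]: a shortest lift of [x - y] plus
    [s - t] is a lift of the new difference. *)
Lemma circle_distD x y s t :
  circle_dist (x + proj s) (y + proj t) <= circle_dist x y + `|s - t|.
Proof.
have [u eu <-] := circle_dist_lift x y.
apply: le_trans (ler_normD _ _); apply: circle_dist_le.
by rewrite projD projB eu opprD addrACA.
Qed.

Lemma circle_dist_proj s t : circle_dist (proj s) (proj t) <= `|s - t|.
Proof. by apply: circle_dist_le; rewrite projB. Qed.

Lemma proj_diff_eq0 s : proj s = 0 -> `|s| < 1 -> s = 0.
Proof.
rewrite -proj0 => /eq_proj; rewrite subr0 => /intrP[m ->].
rewrite -intr_norm -[1]/(1%:~R) ltr_int => m1; suff -> : m = 0 by [].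
by move: m1; case: m => [[]|].
Qed.

(** Links the quotient topology to the metric: [proj] does not increase distances, and a point at
    distance [r] from [proj t] has a lift at distance [r] from [t]. *)
Lemma open_circleP (U : set (circle R)) :
  open U <-> forall x, U x -> exists2 r, 0 < r & forall y, circle_dist x y < r -> U y.
Proof.
split=> [oU x Ux|H].
  have [t et] := proj_surj x.
  have : nbhs t (proj @^-1` U).
    by apply: open_nbhs_nbhs; split; [exact: oU|rewrite /= et].
  move=> /nbhs_ballP[r /= r0 rU]; exists r => // y.
  have [s es <-] := circle_dist_lift x y => sr.
  have -> : y = proj (t - s) by rewrite projB et es opprB addrC subrK.
  by apply: rU; rewrite /ball/= opprB addrC subrK.
suff : open (proj @^-1` U) by [].
rewrite openE => t Ut.
have [r r0 rU] := H _ Ut.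
apply/nbhs_ballP; exists r => //= s; rewrite /ball/= => ts.
by apply: rU; apply: le_lt_trans ts; exact: circle_dist_proj.
Qed.

Lemma open_circle_ball x r : open [set y | circle_dist x y < r].
Proof.
apply/open_circleP => y /= xy; exists (r - circle_dist x y).
  by rewrite subr_gt0.
move=> z; rewrite ltrBrDl; apply: le_lt_trans; exact: circle_dist_triangle.
Qed.

Lemma measurable_circle_ball x r :
  measurable [set y | circle_dist x y < r].
Proof. by apply: sub_sigma_algebra; exact: open_circle_ball. Qed.

Lemma open_circle_ballC x r : open [set y | r < circle_dist x y].
Proof.
apply/open_circleP => y /= xy; exists (circle_dist x y - r).
  by rewrite subr_gt0.
move=> z yz; have := circle_dist_triangle z x y.
rewrite (circle_distC z y) => h; lra.
Qed.

Lemma measurable_circle_cball x r :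
  measurable [set y | circle_dist x y <= r].
Proof.
rewrite -[X in measurable X]setCK; apply: measurableC.
rewrite (_ : ~` _ = [set y | r < circle_dist x y]).
  by apply: sub_sigma_algebra; exact: open_circle_ballC.
by apply/seteqP; split => y /=; rewrite ltNge => /negP.
Qed.

Definition circle_cont (F : circle R -> circle R) :=
  forall x e, 0 < e -> exists2 r, 0 < r &
    forall y, circle_dist x y < r -> circle_dist (F x) (F y) < e.

Lemma circle_cont_measurable F : circle_cont F -> measurable_fun setT F.
Proof.
move=> cF; apply: (@measurability _ _ _ (circle R) _ _ (@open (circle R))) => //.
move=> _ [U oU <-]; rewrite setTI; apply: sub_sigma_algebra.
apply/open_circleP => x /= UFx.
have [e e0 eU] := (open_circleP U).1 oU _ UFx.
have [r r0 rF] := cF x e e0.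
by exists r => // y /rF /eU.
Qed.

Lemma circle_lip_measurable (g : circle R -> R) K :
  (forall x y, `|g x - g y| <= K * circle_dist x y) -> measurable_fun setT g.
Proof.
move=> gK; apply: (measurability _ (RGenOpens.measurableE R)) => //.
move=> _ [_ [a [b ->] <-]]; rewrite setTI; apply: sub_sigma_algebra.
apply/open_circleP => x /= Ugx.
have : nbhs (g x) `]a, b[%classic.
  by apply: open_nbhs_nbhs; split => //; exact: interval_open.
move=> /nbhs_ballP[e /= e0 eU].
(* The constant [|K| + 1] is positive whatever the sign of [K]. *)
have K0 : 0 < `|K| + 1 by rewrite ltr_wpDl.
exists (e / (`|K| + 1)); first by rewrite divr_gt0.
move=> y; rewrite ltr_pdivlMr// => ye; apply: eU; rewrite /ball/=.
apply: le_lt_trans (gK _ _) _; apply: le_lt_trans ye.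
rewrite mulrC ler_wpM2l ?circle_dist_ge0//.
by rewrite (le_trans (ler_norm _))// lerDl.
Qed.

End circle_dist.

(** * Completeness of the circle *)

Section complete.
Variable R : realType.

(** The increments lift to reals of the same size, whose series converges by comparison with a
    geometric one; its sum projects to the limit. *)
Lemma circle_geometric_limit (u : nat -> circle R) (c q : R) :
  0 <= q < 1 -> (forall n, circle_dist (u n) (u n.+1) <= c * q ^+ n) ->
  exists l, forall e, 0 < e -> exists n0, forall n, (n0 <= n)%N ->
    circle_dist (u n) l < e.
Proof.
move=> /andP[q0 q1] H.
have [t tu] : {t : nat -> R & forall n, proj (t n) = u n.+1 - u n /\
    `|t n| <= c * q ^+ n}.
  apply: (@choice _ _ (fun n s => proj s = u n.+1 - u n /\ `|s| <= c * q ^+ n)).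
  move=> n.
  have [s es sE] := circle_dist_lift (u n.+1) (u n).
  by exists s; split=> //; rewrite sE circle_distC.
have cvt : cvgn (series t).
  apply: normed_cvg; apply: (@series_le_cvg _ _ (geometric c q)).
  - by move=> n /=.
  - by move=> n; exact: le_trans (normr_ge0 _) (tu n).2.
  - by move=> n; exact: (tu n).2.
  - by apply: is_cvg_geometric_series; rewrite ger0_norm.
have uE n : u n = u 0%N + proj (series t n).
  elim: n => [|n IH]; first by rewrite /series/= big_nil proj0 addr0.
  by rewrite seriesSr projD (tu n).1 addrA -IH addrC subrK.
exists (u 0%N + proj (limn (series t))) => e e0.
have /cvgrPdist_lt/(_ e e0)[n0 _ n0P] := cvt.
exists n0 => n /n0P /=; rewrite {1}uE distrC; apply: le_lt_trans.
by rewrite (le_trans (circle_distD _ _ _ _))// circle_distxx add0r.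
Qed.

End complete.

(** * Derivatives of circle maps *)

Section circle_deriv.
Variable R : realType.
Implicit Types (x y z : circle R) (s t D : R) (f g : circle R -> circle R).

(* [g] is [f] read in the charts centred at [x] and [f x]. *)
Definition circle_deriv f x D : Prop := exists g : R -> R,
  [/\ g 0 = 0, is_derive (0 : R) (1 : R) g D &
      \forall t \near (0 : R), f (x + proj t) = f x + proj (g t)].

Lemma circle_deriv_id x : circle_deriv id x 1.
Proof.
exists id; split=> //; first exact: is_derive_id.
by near=> t.
Unshelve. all: by end_near. Qed.

Lemma is_derive_cvg0 (g : R -> R) D : g 0 = 0 -> is_derive (0 : R) (1 : R) g D ->
  g t @[t --> (0 : R)] --> (0 : R).
Proof.
move=> g0 [dg _]; rewrite -[X in _ --> X]g0.
exact: (differentiable_continuous ((derivable1_diffP _ _).1 dg)).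
Qed.

Lemma circle_deriv_comp f1 f2 x D1 D2 :
  circle_deriv f1 x D1 -> circle_deriv f2 (f1 x) D2 ->
  circle_deriv (f2 \o f1) x (D2 * D1).
Proof.
move=> [g1 [g10 dg1 fg1]] [g2 [g20 dg2 fg2]].
exists (g2 \o g1); split; first by rewrite /= g10.
  by apply: is_derive1_comp => //; rewrite g10.
have n2 : \forall t \near (0 : R), f2 (f1 x + proj (g1 t)) = f2 (f1 x) + proj (g2 (g1 t)).
  exact: (is_derive_cvg0 g10 dg1 fg2).
near=> t; have e1 : f1 (x + proj t) = f1 x + proj (g1 t) by near: t.
by rewrite /= e1; near: t.
Unshelve. all: by end_near. Qed.

(** Two local expressions of [f] differ by an integer and are both below 1/2 near 0, so they
    coincide there. *)
Lemma circle_deriv_unique f x D1 D2 :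
  circle_deriv f x D1 -> circle_deriv f x D2 -> D1 = D2.
Proof.
move=> [g1 [g10 dg1 fg1]] [g2 [g20 dg2 fg2]].
have g1c := is_derive_cvg0 g10 dg1; have g2c := is_derive_cvg0 g20 dg2.
have E : \forall t \near (0 : R), g1 t = g2 t.
  have n1 : \forall t \near (0 : R), `|g1 t| < 2^-1.
    by apply: (cvgr0_norm_lt g1 g1c); rewrite invr_gt0.
  have n2 : \forall t \near (0 : R), `|g2 t| < 2^-1.
    by apply: (cvgr0_norm_lt g2 g2c); rewrite invr_gt0.
  near=> t; apply/eqP; rewrite -subr_eq0; apply/eqP; apply: proj_diff_eq0.
    have e1 : f (x + proj t) = f x + proj (g1 t) by near: t.
    have e2 : f (x + proj t) = f x + proj (g2 t) by near: t.
    by apply: (addrI (f x)); rewrite addr0 projB addrA -e1 e2 addrK.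
  have h1 : `|g1 t| < 2^-1 by near: t.
  have h2 : `|g2 t| < 2^-1 by near: t.
  by apply: le_lt_trans (ler_normB _ _) _; lra.
have [_ <-] := near_eq_is_derive E dg1.
by have [_ <-] := dg2.
Unshelve. all: by end_near. Qed.

Lemma circle_deriv_iter f (D : circle R -> R) x :
  (forall y, circle_deriv f y (D y)) -> forall k,
  circle_deriv (iter k f) x (\prod_(l < k) D (iter l f x)).
Proof.
move=> fD; elim=> [|k IH]; first by rewrite big_ord0; exact: circle_deriv_id.
by rewrite big_ord_recr/= mulrC; exact: (circle_deriv_comp IH).
Qed.

End circle_deriv.

(** * Mean value estimates for circle maps *)

Section smooth.
Variable R : realType.

Lemma ler_mvt (g dg : R -> R) (K lo hi s t : R) :
  (forall u, lo <= u <= hi -> is_derive u (1 : R) g (dg u) /\ `|dg u| <= K) ->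
  lo <= s <= hi -> lo <= t <= hi -> `|g s - g t| <= K * `|s - t|.
Proof.
move=> H; wlog st : s t / s <= t.
  move=> wl hs ht; have [st|ts] := leP s t; first exact: wl.
  by rewrite distrC [`|s - t|]distrC; apply: wl => //; exact: ltW.
move=> /andP[ls _] /andP[_ th].
have inI u : u \in `[s, t] -> lo <= u <= hi.
  by rewrite in_itv/= => /andP[su ut]; rewrite (le_trans ls su) (le_trans ut th).
have [u|u|c ci e] := @MVT_segment _ g dg _ _ st.
- by move=> /subset_itv_oo_cc /inI /H[].
- apply: derivable_within_continuous => v /inI /H[dv _].
  exact: ex_derive.
- rewrite distrC e normrM [`|s - t|]distrC ler_wpM2r//.
  by have [] := H _ (inI _ ci).
Qed.

(** In a chart the derivative is continuous, so its absolute value stays below [|D| + e] near the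
    point, and the mean value inequality gives the local Lipschitz bound. *)
Lemma circle_class_C2_deriv (f : circle R -> circle R) x :
  circle_class_C 2 f -> exists2 D, circle_deriv f x D &
    forall e, 0 < e -> exists2 r, 0 < r & forall y z,
      circle_dist x y < r -> circle_dist x z < r ->
      circle_dist (f y) (f z) <= (`|D| + e) * circle_dist y z.
Proof.
have [a <-] := proj_surj x.
move=> /(_ a)[U [g [oU Ua [dg /(_ 1)[dg' _]] fg]]].
have gD u : U u -> is_derive u (1 : R) g ('d g u 1).
  move=> Uu; rewrite -deriveE//; last exact: dg.
  by apply: derivableP; apply/derivable1_diffP; exact: dg.
have [r1 /= r10 r1U] : exists2 r, 0 < r & ball a r `<=` U.
  by apply/nbhs_ballP; exact: open_nbhs_nbhs.
exists ('d g a 1).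
  exists (fun t => g (a + t) - g a); split; first by rewrite addr0 subrr.
    have d1 : is_derive (0 : R) (1 : R) (fun t : R => a + t) (1 : R).
      have h := is_deriveD (is_derive_cst a (0 : R) (1 : R)) (is_derive_id (0 : R) (1 : R)).
      by apply: (is_derive_eq h); rewrite add0r.
    have d2 : is_derive (a + 0) (1 : R) g ('d g a 1) by rewrite addr0; exact: gD.
    have d3 := is_derive1_comp d2 d1.
    have h := is_deriveB d3 (is_derive_cst (g a) (0 : R) (1 : R)).
    by apply: (is_derive_eq h); rewrite mulr1 subr0.
  apply/nbhs_ballP; exists r1 => //= t; rewrite /ball/= sub0r normrN => tr.
  rewrite -projD fg; last by apply: r1U; rewrite /ball/= opprD addNKr normrN.
  by rewrite fg// -projD [g a + _]addrC subrK.
move=> e e0.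
have : \forall u \near a, `|'d g u 1| < `|'d g a 1| + e.
  have cg : 'd g u 1 @[u --> a] --> 'd g a 1.
    exact: (differentiable_continuous (dg' _ Ua)).
  by apply: (cvgr_norm_lt ('d g a 1) cg); rewrite ltrDl.
move=> /nbhs_ballP[r2 /= r20 r2g].
(* Lifts within 1/4 of [a] differ by at most 1/2, so their difference computes the distance of their
   projections. *)
exists (Num.min (Num.min r1 r2) 4^-1); first by rewrite !lt_min r10 r20 invr_gt0/=.
move=> y z.
have lift w : circle_dist (proj a) w < Num.min (Num.min r1 r2) 4^-1 ->
    exists2 u, w = proj u & [/\ `|a - u| < r1, `|a - u| < r2 & `|a - u| < 4^-1].
  have [s es <-] := circle_dist_lift (proj a) w.
  rewrite !lt_min => /andP[/andP[s1 s2] s3].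
  exists (a - s); first by rewrite projB es opprB addrC subrK.
  by rewrite opprB addrC subrK.
move=> /lift[s -> [s1 s2 s3]] /lift[t -> [t1 t2 t3]].
rewrite (@circle_dist_norm _ (proj s) (proj t) (s - t)) ?projB//; last first.
  by move: s3 t3; rewrite !ltr_norml ler_norml => /andP[? ?] /andP[? ?]; lra.
rewrite !fg; [|exact: r1U..].
apply: le_trans (circle_dist_proj _ _) _.
(* The segment between the two lifts lies in the balls around [a] where [g] is differentiable and
   its derivative is controlled. *)
apply: (@ler_mvt g (fun u => 'd g u 1) _ (Num.min s t) (Num.max s t)); last 2 first.
- by rewrite ge_min le_max !lexx.
- by rewrite ge_min le_max !lexx !orbT.
move=> u /andP[]; rewrite ge_min le_max => hu1 hu2.
have uB r : `|a - s| < r -> `|a - t| < r -> `|a - u| < r.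
  move=> /ltr_normlP[? ?] /ltr_normlP[? ?]; apply/ltr_normlP.
  by move: hu1 hu2 => /orP[?|?] /orP[?|?]; split; lra.
split; first by apply/gD/r1U/uB.
by apply/ltW/r2g/uB.
Qed.

End smooth.

(** * Bounds for the interaction functions *)

Section interaction.
Variable R : realType.

(** The difference quotients of [H] in direction [(1, 0)] are those of the slice. *)
Lemma is_derive_slice1 (H : R * R -> R) (u b : R) :
  differentiable H (u, b) ->
  is_derive u (1 : R) (fun s => H (s, b)) ('d H (u, b) (1, 0)).
Proof.
move=> dH; have [dv e] : is_derive (u, b) (1, 0) H ('d H (u, b) (1, 0)).
  by rewrite -deriveE//; apply: derivableP; exact: diff_derivable.
have E : (fun h : R => h^-1 *: ((H \o shift (u, b)) (h *: (1, 0)) - H (u, b))) =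
         (fun h : R => h^-1 *: (((fun s => H (s, b)) \o shift u) (h *: 1) - H (u, b))).
  by apply/funext => h /=; congr (_ *: (H (_, _) - _)); rewrite /= scaler0 add0r.
by split; [rewrite /derivable -E|rewrite -e /derive -E].
Qed.

Lemma is_derive_slice2 (H : R * R -> R) (u b : R) :
  differentiable H (b, u) ->
  is_derive u (1 : R) (fun s => H (b, s)) ('d H (b, u) (0, 1)).
Proof.
move=> dH; have [dv e] : is_derive (b, u) (0, 1) H ('d H (b, u) (0, 1)).
  by rewrite -deriveE//; apply: derivableP; exact: diff_derivable.
have E : (fun h : R => h^-1 *: ((H \o shift (b, u)) (h *: (0, 1)) - H (b, u))) =
         (fun h : R => h^-1 *: (((fun s => H (b, s)) \o shift u) (h *: 1) - H (b, u))).
  by apply/funext => h /=; congr (_ *: (H (_, _) - _)); rewrite /= scaler0 add0r.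
by split; [rewrite /derivable -E|rewrite -e /derive -E].
Qed.

Lemma continuous_bounded_square (F : R * R -> R) (a b : R) : continuous F ->
  exists2 B, 0 < B & forall s t, a <= s <= b -> a <= t <= b -> `|F (s, t)| <= B.
Proof.
move=> cF; have cK : compact (`[a, b]%classic `*` `[a, b]%classic).
  by apply: compact_setX; exact: segment_compact.
have /compact_bounded/pinfty_ex_gt0[B B0 BK] :
    compact (F @` (`[a, b]%classic `*` `[a, b]%classic)).
  by apply: continuous_compact => //; exact: continuous_subspaceT.
exists B => // s t sab tab; by apply: BK; exists (s, t).
Qed.

Lemma circle_rep01 (x : circle R) : exists2 a, proj a = x & 0 <= a <= 1.
Proof.
have [t <-] := proj_surj x; exists (t - (Num.floor t)%:~R).
  apply/eq_proj; rewrite addrAC subrr add0r rpredN; exact: intr_int.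
have /andP[] := floor_itv t.
rewrite intrD => h1 h2; apply/andP; split; lra.
Qed.

(** The lift of [h] and its partial derivatives are continuous, hence bounded on a compact square;
    the mean value inequality is applied to one variable at a time. *)
Lemma circle2_class_C2_lipschitz (h : circle R -> circle R -> R) :
  circle2_class_C 2 h -> exists M L, [/\ 0 < M, 0 < L,
    forall x y, `|h x y| <= M &
    forall x y x' y', `|h x y - h x' y'| <=
      L * (circle_dist x x' + circle_dist y y')].
Proof.
pose H (p : R * R) := h (proj p.1) (proj p.2).
move=> [dH dH2].
have cH : continuous H by move=> p; exact: differentiable_continuous (dH p I).
have cdH v : continuous (fun p => 'd H p v).
  by move=> p; apply: differentiable_continuous; exact: ((dH2 v).1 p I).
(* A representative in [[0, 1]] moved by a shortest lift, of size at most 1/2, stays in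
   [[-1, 2]]. *)
have [M M0 HM] := @continuous_bounded_square _ (-1) 2 cH.
have [L1 L10 HL1] := @continuous_bounded_square _ (-1) 2 (cdH (1, 0)).
have [L2 L20 HL2] := @continuous_bounded_square _ (-1) 2 (cdH (0, 1)).
have in01 (a : R) : 0 <= a <= 1 -> -1 <= a <= 2.
  by move=> /andP[? ?]; apply/andP; split; lra.
have in01D (a t : R) : 0 <= a <= 1 -> `|t| <= 2^-1 -> -1 <= a + t <= 2.
  by move=> /andP[? ?] /ler_normlP[? ?]; apply/andP; split; lra.
have lip1 x x' y : `|h x y - h x' y| <= L1 * circle_dist x x'.
  have [a ax a01] := circle_rep01 x; have [b by_ b01] := circle_rep01 y.
  have [t et t2] := circle_dist_lift x' x.
  have -> : x' = proj (a + t) by rewrite projD ax et addrC subrK.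
  have -> : circle_dist x (proj (a + t)) = `|a - (a + t)|.
    by rewrite opprD addNKr normrN t2 projD ax et [x + _]addrC subrK circle_distC.
  rewrite -ax -by_.
  apply: (@ler_mvt _ (fun s => H (s, b)) (fun u => 'd H (u, b) (1, 0)) _ (-1) 2).
  - by move=> u u12; split; [apply: is_derive_slice1; exact: dH|apply: HL1 => //; exact: in01].
  - exact: in01.
  - by apply: in01D => //; rewrite t2 circle_dist_half.
have lip2 x y y' : `|h x y - h x y'| <= L2 * circle_dist y y'.
  have [b bx b01] := circle_rep01 x; have [a ay a01] := circle_rep01 y.
  have [t et t2] := circle_dist_lift y' y.
  have -> : y' = proj (a + t) by rewrite projD ay et addrC subrK.
  have -> : circle_dist y (proj (a + t)) = `|a - (a + t)|.
    by rewrite opprD addNKr normrN t2 projD ay et [y + _]addrC subrK circle_distC.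
  rewrite -ay -bx.
  apply: (@ler_mvt _ (fun s => H (b, s)) (fun u => 'd H (b, u) (0, 1)) _ (-1) 2).
  - by move=> u u12; split; [apply: is_derive_slice2; exact: dH|apply: HL2 => //; exact: in01].
  - exact: in01.
  - by apply: in01D => //; rewrite t2 circle_dist_half.
exists M, (L1 + L2); split=> //; first exact: addr_gt0.
  move=> x y; have [a <- a01] := circle_rep01 x; have [b <- b01] := circle_rep01 y.
  by apply: (HM a b); exact: in01.
move=> x y x' y'; apply: le_trans (ler_distD (h x' y) _ _) _.
have := lip1 x x' y; have := lip2 x' y y'.
have := circle_dist_ge0 x x'; have := circle_dist_ge0 y y'; nra.
Qed.

End interaction.

(** * Adapted weights along a periodic orbit *)

Section periodic_orbit.
Variable R : realType.

Lemma fin_lower_bound (I : finType) (F : I -> R) :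
  (forall i, 0 < F i) -> exists2 m, 0 < m & forall i, m <= F i.
Proof.
(* The default 1 keeps the minimum positive when [I] is empty. *)
move=> F0; exists (\big[Num.min/1]_i F i); first by rewrite lt_bigmin.
by move=> i; exact: bigmin_le_cond.
Qed.

Lemma fin_upper_bound (I : finType) (F : I -> R) :
  (forall i, 0 < F i) -> exists2 m, 0 < m & forall i, F i <= m.
Proof.
move=> F0; have [i|m m0 mF] := @fin_lower_bound I (fun i => (F i)^-1).
  by rewrite invr_gt0.
exists m^-1; first by rewrite invr_gt0.
by move=> i; rewrite -[F i]invrK lef_pV2 ?posrE ?invr_gt0.
Qed.

Lemma le_mx_norm_coord (N : nat) (v : 'rV[R]_N) i : `|v 0 i| <= `|v|.
Proof. by rewrite [`|v|]mx_normrE; exact: (le_bigmax _ _ (0, i)). Qed.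

Lemma mx_norm_delta_le (N : nat) (i : 'I_N) : `|delta_mx 0 i : 'rV[R]_N| <= 1.
Proof.
rewrite [X in X <= _]mx_normrE; apply: bigmax_le => // j _.
by rewrite mxE; case: (_ && _); rewrite ?normr1 ?normr0.
Qed.

(** Restricting the chart to the line spanned by the [i]-th basis vector [e] gives the derivative of
    [F] as the [i]-th entry of [A e], which the operator norm bounds because [|e| <= 1]. *)
Lemma torus_diff_coord (N : nat) (T : torus R N -> torus R N) (x : torus R N)
    (A : 'rV[R]_N -> 'rV[R]_N) (F : circle R -> circle R) (i : 'I_N) (lambda : R) :
  (forall y, T y 0 i = F (y 0 i)) -> torus_diff T x A ->
  (opnorm A <= lambda%:E)%E ->
  exists2 D, circle_deriv F (x 0 i) D & `|D| <= lambda.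
Proof.
move=> TF [g [g0 dg gA gT]] Al; pose e : 'rV[R]_N := delta_mx 0 i.
exists (A e 0 i); last first.
  have Ae : (`|A e|%:E <= opnorm A)%E.
    by apply: ereal_sup_ubound; exists e => //; exact: mx_norm_delta_le.
  by apply: le_trans (le_mx_norm_coord _ _) _; rewrite -lee_fin (le_trans Ae).
exists (fun t => g (t *: e) 0 i); split; first by rewrite scale0r g0 mxE.
  have dv : derivable g 0 e by exact: diff_derivable.
  have lv : 'D_e g 0 = A e by rewrite deriveE// gA.
  have cg : (fun h : R => h^-1 *: ((g \o shift 0) (h *: e) - g 0)) @ 0^' --> A e.
    by rewrite -lv; exact: dv.
  have FF : Filter ((0 : R)^') by exact: dnbhs_filter.
  have := @continuous_cvg _ _ _ _ FF _ _ (A e) (@coord_continuous R 1 N 0 i (A e)) cg.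
  set G0 := (_ \o _).
  have -> : G0 = (fun h : R => h^-1 *:
      (((fun t => g (t *: e) 0 i) \o shift 0) (h *: 1) - g (0 *: e) 0 i)).
    by apply/funext => h /=; rewrite /G0/= !mxE scale0r !addr0 /GRing.scale/= mulr1.
  move=> cG; split; first exact: (cvgP _ cG).
  by apply: cvg_lim => //; exact: cG.
have cs : (t *: e) @[t --> (0 : R)] --> (0 : 'rV[R]_N).
  by rewrite -[X in _ --> X](scale0r e); exact: scalel_continuous.
have gT' : \forall t \near (0 : R),
    T (x + torus_proj (t *: e)) = T x + torus_proj (g (t *: e)) by exact: cs gT.
near=> t; have : T (x + torus_proj (t *: e)) = T x + torus_proj (g (t *: e)).
  by near: t.
move=> /(congr1 (fun y : torus R N => y 0 i)).
by rewrite TF !mxE !eqxx mulr1 TF.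
Unshelve. all: by end_near. Qed.

Lemma iter_product_map (N : nat) (f : 'I_N -> circle R -> circle R) k y i :
  iter k (product_map f) y 0 i = iter k (f i) (y 0 i).
Proof. by elim: k => //= k IH; rewrite mxE IH. Qed.

Lemma bernoulli_le (d : R) n : 0 <= d <= 1 -> 1 - d *+ n <= (1 - d) ^+ n.
Proof.
move=> /andP[d0 d1]; elim: n => [|n IH]; first by rewrite mulr0n subr0 expr0.
rewrite exprS mulrS; have dn : 0 <= d *+ n by rewrite mulrn_wge0.
have : (1 - d) * (1 - d *+ n) <= (1 - d) * (1 - d) ^+ n.
  by rewrite ler_wpM2l// subr_ge0.
by move: (_ ^+ n) (d *+ n) dn => X Y; nra.
Qed.

Lemma periodic_modn (T : Type) (a : nat -> T) (k : nat) :
  (forall l, a (l + k)%N = a l) -> forall l, a l = a (l %% k)%N.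
Proof.
move=> ak l; rewrite {1}(divn_eq l k).
elim: (l %/ k)%N => [|n IH]; first by rewrite mul0n.
by rewrite mulSn -addnA addnC ak.
Qed.

(* The factor [theta ^+ k] dominates the product of the [a l + e] by Bernoulli's
   inequality for [theta = 1 - (1 - q) / k]; the weights are the partial
   quotients. *)
Lemma cyclic_weights (a : nat -> R) (k : nat) : (0 < k)%N ->
  (forall l, 0 <= a l) -> (forall l, a (l + k)%N = a l) ->
  \prod_(l < k) a l < 1 ->
  exists e theta (w : nat -> R), [/\ 0 < e, 0 < theta < 1,
    forall l, 0 < w l, forall l, w (l + k)%N = w l &
    forall l, w l.+1 * (a l + e) <= theta * w l].
Proof.
move=> k0 a0 ak ak1.
have amod l : a l = a (l %% k)%N by exact: periodic_modn.
have [e e0 pe1] : exists2 e, 0 < e & \prod_(l < k) (a l + e) < 1.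
  (* The product is a polynomial in [e], so by continuity it stays below 1 for some positive [e]. *)
  pose p : {poly R} := \prod_(l < k) ((a l)%:P + 'X).
  have pE e : p.[e] = \prod_(l < k) (a l + e).
    by rewrite horner_prod; apply: eq_bigr => l _; rewrite !hornerE.
  have p01 : p.[0] < 1.
    by rewrite pE; under eq_bigr do rewrite addr0.
  have : \forall e \near (0 : R), p.[e] < 1.
    have cp : p.[e] @[e --> (0 : R)] --> p.[0] by exact: continuous_horner.
    by apply: (cvgr_lt _ cp).
  move=> /nbhs_ballP[r /= r0 rp]; exists (r / 2); first by rewrite divr_gt0.
  rewrite -pE; apply: rp; rewrite /ball/= sub0r normrN gtr0_norm ?divr_gt0//.
  by rewrite ltr_pdivrMr// ltr_pMr// ltr1n.
set q := \prod_(l < k) _ in pe1.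
have ae l : 0 < a l + e by rewrite ltr_wpDl.
have q0 : 0 < q by apply: prodr_gt0.
have kR : 1 <= k%:R :> R by rewrite ler1n.
pose d := (1 - q) / k%:R.
have d0 : 0 < d by rewrite divr_gt0 ?subr_gt0// (lt_le_trans ltr01).
have d1 : d < 1.
  rewrite ltr_pdivrMr ?(lt_le_trans ltr01)// mul1r; apply: lt_le_trans kR.
  by rewrite gtrBl.
have qd : q <= (1 - d) ^+ k.
  apply: le_trans (bernoulli_le _ _); last by rewrite !ltW.
  rewrite -mulr_natr divfK ?subKr//.
  by rewrite gt_eqF// (lt_le_trans ltr01).
pose P m := \prod_(j < m) (a j + e).
have P0 m : 0 < P m by apply: prodr_gt0.
exists e, (1 - d), (fun l => (1 - d) ^+ (l %% k) / P (l %% k)%N); split=> //.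
- by rewrite subr_gt0 d1 gtrBl d0.
- by move=> l; rewrite divr_gt0// exprn_gt0// subr_gt0.
- by move=> l; rewrite modnDr.
move=> l; rewrite modnS amod; set m := (l %% k)%N.
have mk : (m < k)%N by rewrite ltn_mod.
(* At the end of a period the weight returns to 1 and the inequality is [q <= (1 - d) ^+ k].
   Elsewhere it is an equality by the choice of the weights. *)
case: ifPn => kl.
  have mE : m.+1 = k.
    apply/eqP; rewrite eqn_leq mk/= dvdn_leq//.
    by rewrite /dvdn -addn1 modnDml addn1.
  rewrite expr0 /P big_ord0 divr1 mul1r mulrA -exprS mE -/(P m).
  rewrite ler_pdivlMr// mulrC; move: qd; rewrite /q -mE big_ord_recr.
  by rewrite mulrC [_ * P m]mulrC.
rewrite /P big_ord_recr/= -/(P m) exprS invfM.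
rewrite -[_ * _ * _ * (a m + e)]mulrA -[_^-1 * _^-1 * _]mulrA mulVf ?gt_eqF//.
by rewrite mulr1 mulrA.
Qed.

End periodic_orbit.

(** * Measures on the circle *)

Section probability_bounds.
Variable R : realType.

(** Every point off the support has a null neighbourhood. By second countability, countably many
    null balls cover the complement of [K]. *)
Lemma probability_support (mu : probability (circle R) R) (K : set (circle R)) :
  open (~` K) -> msupport mu `<=` K -> mu K = 1%E.
Proof.
move=> oK sK.
have mV : measurable (~` K) by exact: sub_sigma_algebra.
pose B (p : rat * nat) := [set y | circle_dist (proj (ratr p.1 : R)) y < p.2.+1%:R^-1].
(* Enumerates the balls with rational centre and radius [1/(n+1)], replacing those of positive
   measure by the empty set. *)
pose F n := if unpickle n is Some p then
  if mu (B p) == 0%E then B p else set0 else set0.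
have F0 : mu.-negligible (\bigcup_n F n).
  apply: negligible_bigcup => n; rewrite /F.
  case: (unpickle n) => [p|]; last exact: negligible_set0.
  case: eqP => [p0|_]; last exact: negligible_set0.
  by exists (B p); split=> //; exact: measurable_circle_ball.
have V0 : mu (~` K) = 0%E.
  apply: measure_negligible => //; apply: negligibleS F0 => x Kx.
  have [U [oU Ux U0]] : exists U, [/\ open U, U x & mu U = 0%E].
    have : ~ msupport mu x by move=> /sK.
    rewrite /msupport/= -existsNP => -[U].
    rewrite -existsNP => -[oU]; rewrite -existsNP => -[Ux /negP].
    rewrite -leNgt => U0; exists U; split=> //.
    by apply/eqP; rewrite eq_le U0 measure_ge0.
  have [r r0 rU] := (open_circleP U).1 oU _ Ux.
  have [t et] := proj_surj x.
  have r20 : 0 < r / 2 by rewrite divr_gt0.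
  (* A ball of radius below [r / 2] that contains [x] lies in the ball of radius [r] around [x],
     hence in [U]. *)
  have [m mr] : exists m : nat, m.+1%:R^-1 < r / 2.
    exists (Num.trunc (r / 2)^-1).
    by rewrite invf_plt ?posrE// truncnS_gt.
  have [s sE] : exists s : R, s = m.+1%:R^-1 by eexists.
  have s0 : 0 < s by rewrite sE invr_gt0.
  rewrite -sE in mr.
  have ts : t - s < t + s by lra.
  have [q] := rat_in_itvoo ts.
  rewrite in_itv/= => /andP[q1 q2].
  have qt : `|ratr q - t| < s by rewrite ltr_norml; apply/andP; split; lra.
  have Bx : B (q, m) x.
    by rewrite /B/= -et -sE; apply: le_lt_trans qt; exact: circle_dist_proj.
  have BU : B (q, m) `<=` U.
    move=> y By; apply: rU; apply: le_lt_trans (circle_dist_triangle (proj (ratr q)) _ _) _.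
    by rewrite circle_distC; move: Bx By; rewrite /B/= -sE => h1 h2; lra.
  suff Fx : F (pickle (q, m)) x by exact: (ex_intro2 _ _ (pickle (q, m)) I Fx).
  rewrite /F pickleK.
  have -> : mu (B (q, m)) = 0%E.
    apply/eqP; rewrite eq_le measure_ge0 andbT -U0.
    apply: le_measure => //; rewrite inE; first exact: measurable_circle_ball.
    exact: sub_sigma_algebra.
  by rewrite eqxx.
have mK : measurable K by rewrite -[K]setCK; exact: measurableC.
by have := probability_setC mu mV; rewrite setCK V0 sube0.
Qed.

Lemma bounded_integrable d (T : measurableType d) (P : probability T R)
    (g : T -> R) (B : R) : measurable_fun setT g -> (forall x, `|g x| <= B) ->
  P.-integrable setT (EFin \o g).
Proof.
move=> mg gB; apply: measurable_bounded_integrable => //.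
  by apply: le_lt_trans (probability_le1 P measurableT) _; rewrite ltry.
exists B; split; first exact: num_real.
by move=> M BM x _ /=; rewrite (le_trans (gB x))// ltW.
Qed.

(** The complement of [K] is null, so both integrals may be restricted to [K], where the integrands
    are [e]-close. *)
Lemma Rintegral_close d (T : measurableType d) (P : probability T R)
    (K : set T) (g1 g2 : T -> R) (B e : R) : measurable K -> P K = 1%E ->
  measurable_fun setT g1 -> measurable_fun setT g2 ->
  (forall x, `|g1 x| <= B) -> (forall x, `|g2 x| <= B) ->
  (forall x, K x -> `|g1 x - g2 x| <= e) ->
  `|fine (\int[P]_x (g1 x)%:E) - fine (\int[P]_x (g2 x)%:E)| <= e.
Proof.
move=> mK PK m1 m2 B1 B2 g12.
have i1 := bounded_integrable P m1 B1; have i2 := bounded_integrable P m2 B2.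
have m12 : measurable_fun setT (fun x => g1 x - g2 x) by exact: measurable_funB.
have i12 : P.-integrable setT (EFin \o (fun x => g1 x - g2 x)).
  by apply: (@bounded_integrable _ _ _ _ (B + B)) => // x;
    rewrite (le_trans (ler_normB _ _))// lerD.
have iK : P.-integrable K (EFin \o (fun x => g1 x - g2 x)).
  exact: integrableS i12.
rewrite -[fine _ - fine _]/(\int[P]_x g1 x - \int[P]_x g2 x)%R -RintegralB//.
have -> : (\int[P]_x (g1 x - g2 x) = \int[P]_(x in K) (g1 x - g2 x))%R.
  rewrite /Rintegral (@negligible_integral _ _ _ _ _ (~` K))//.
  - by rewrite setTD setCK.
  - exact: measurableC.
  - have := probability_setC P mK.
    by rewrite PK subee.
apply: le_trans (le_normr_Rintegral _ _) _ => //.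
have -> : e = (\int[P]_(x in K) e)%R.
  transitivity (e * fine (P K)); first by rewrite PK mulr1.
  by rewrite Rintegral_cst.
apply: le_Rintegral => //.
  by have := integrable_norm iK; apply.
apply: integrableS (@bounded_integrable _ _ P (cst e) `|e| _ _) => //.
Qed.

Lemma Rintegral_close_cst d (T : measurableType d) (P : probability T R)
    (K : set T) (g : T -> R) (a B e : R) : measurable K -> P K = 1%E ->
  measurable_fun setT g -> (forall x, `|g x| <= B) ->
  (forall x, K x -> `|g x - a| <= e) ->
  `|fine (\int[P]_x (g x)%:E) - a| <= e.
Proof.
move=> mK PK mg gB ga.
have <- : fine (\int[P]_x (cst a x)%:E)%E = a.
  transitivity (a * fine (P setT)); last by rewrite probability_setT mulr1.
  exact: (@Rintegral_cst _ _ _ P setT measurableT a).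
apply: (@Rintegral_close _ _ P K g (cst a) (Num.max B `|a|)) => // x.
  by rewrite le_max gB.
by rewrite le_max lexx orbT.
Qed.

Lemma integral_pushforward_bounded (P : probability (circle R) R)
    (Phi : circle R -> circle R) (g : circle R -> R) (B : R) :
  measurable_fun setT Phi -> measurable_fun setT g -> (forall x, `|g x| <= B) ->
  (\int[pushforward P Phi]_x (g x)%:E = \int[P]_x (g (Phi x))%:E)%E.
Proof.
move=> mPhi mg gB; rewrite integral_pushforward//; first exact/measurable_EFinP.
rewrite preimage_setT; apply: (@bounded_integrable _ _ _ (g \o Phi) B).
  exact: measurableT_comp.
by move=> x; exact: gB.
Qed.

(** A test function is 1-Lipschitz, so on [K] its value at [Phi z] is within [e] of its value at
    [a]. It is bounded, hence integrable, since the circle has finite diameter. *)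
Lemma wasserstein_pushforward_dirac (P : probability (circle R) R)
    (K : set (circle R)) (Phi : circle R -> circle R) (a : circle R) (e : R) :
  measurable K -> P K = 1%E -> measurable_fun setT Phi ->
  (forall z, K z -> circle_dist (Phi z) a <= e) ->
  (wasserstein (pushforward P Phi) (\d_a) <= e%:E)%E.
Proof.
move=> mK PK mPhi Ke; apply: ge_ereal_sup => _ [phi phi1 <-].
have mphi : measurable_fun setT phi.
  by apply: (@circle_lip_measurable _ _ 1) => x y; rewrite mul1r.
have bphi x : `|phi x| <= `|phi a| + 1.
  have := phi1 x a; have := circle_dist_half x a => h1 h2.
  have := ler_normD (phi x - phi a) (phi a); rewrite subrK; lra.
have mc : measurable_fun setT (phi \o Phi) by exact: measurableT_comp.
rewrite (integral_pushforward_bounded _ mPhi mphi bphi).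
rewrite integral_dirac ?diracT ?mul1e//; last exact/measurable_EFinP.
have iP := bounded_integrable P mc (fun x => bphi (Phi x)).
rewrite -(fineK (integrable_fin_num _ iP))// -EFinB lee_fin.
apply: le_trans (ler_norm _) _.
apply: (Rintegral_close_cst mK PK mc (fun x => bphi (Phi x))) => x /Ke.
by apply: le_trans; exact: phi1.
Qed.

End probability_bounds.

(** * Contraction of the coupled dynamics *)

Section coupled_dynamics.
Variables (R : realType) (N : nat).
Variables (f : 'I_N -> circle R -> circle R)
          (h : 'I_N -> 'I_N -> circle R -> circle R -> R)
          (alpha : 'M[R]_N).
(** [p l] is the uncoupled orbit at time [l] and [w l] its adapted weights; [b] is the weighted
    radius of the boxes around the orbit, and [eps] bounds the coupling strengths. *)
Variables (p : nat -> 'I_N -> circle R) (w : nat -> 'I_N -> R).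
Variables (theta Lambda rho M L eps c W b : R).

Hypothesis c_gt0 : 0 < c.
Hypothesis w_bounds : forall l i, c <= w l i <= W.
Hypothesis p_orbit : forall l i, p l.+1 i = f i (p l i).
Hypothesis theta_ge0 : 0 <= theta.
Hypothesis f_contract : forall l i y z,
  circle_dist (p l i) y < rho -> circle_dist (p l i) z < rho ->
  w l.+1 i * circle_dist (f i y) (f i z) <= theta * (w l i * circle_dist y z).
Hypothesis h_bound : forall i j y z, `|h i j y z| <= M.
Hypothesis L_ge0 : 0 <= L.
Hypothesis h_lip : forall i j y z y' z',
  `|h i j y z - h i j y' z'| <= L * (circle_dist y y' + circle_dist z z').
Hypothesis eps_ge0 : 0 <= eps.
Hypothesis alpha_le : forall i j, `|alpha i j| <= eps.
Hypothesis b_gt0 : 0 < b.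
Hypothesis M_ge0 : 0 <= M.
(** Three smallness conditions on the coupling: points of the doubled boxes stay, after the coupling
    shift, where [f] contracts; each box is mapped into the next; the variation of the coupling
    leaves a contraction factor [Lambda]. *)
Hypothesis box_lt_rho : 2 * b / c + eps * N%:R * M < rho.
Hypothesis box_stable : theta * (b + W * (eps * N%:R * M)) <= b.
Hypothesis Lambda_gt : theta * (1 + W * (eps * N%:R * (L * (2 / c)))) <= Lambda.
Hypothesis Lambda_itv : 0 < Lambda < 1.

Local Notation G := (coupled_map f h alpha).

Let w_gt0 l i : 0 < w l i.
Proof. by have /andP[cw _] := w_bounds l i; exact: lt_le_trans cw. Qed.

Let w_ge0 l i : 0 <= w l i. Proof. exact: ltW. Qed.

Let dist_le_c l i y z e : w l i * circle_dist y z <= e -> circle_dist y z <= e / c.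
Proof.
have /andP[cw _] := w_bounds l i => h1; rewrite ler_pdivlMr// mulrC.
by apply: le_trans h1; rewrite ler_wpM2r// circle_dist_ge0.
Qed.

Lemma coupling_le i (u : 'I_N -> R) (B : R) : (forall j, `|u j| <= B) ->
  `|\sum_j alpha i j * u j| <= eps * N%:R * B.
Proof.
move=> uB; apply: le_trans (ler_norm_sum _ _ _) _.
rewrite mulrAC mulr_natr -[N in _ *+ N]card_ord -sumr_const.
by apply: ler_sum => j _; rewrite normrM ler_pM.
Qed.

Lemma coupling_dist_le i (u v : 'I_N -> R) (B : R) :
  (forall j, `|u j - v j| <= B) ->
  `|\sum_j alpha i j * u j - \sum_j alpha i j * v j| <= eps * N%:R * B.
Proof.
move=> uvB; rewrite -sumrB; under eq_bigr do rewrite -mulrBr.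
exact: coupling_le.
Qed.

Lemma shifted_contract l i y z s t :
  circle_dist (p l i) y + `|s| < rho -> circle_dist (p l i) z + `|t| < rho ->
  w l.+1 i * circle_dist (f i (y + proj s)) (f i (z + proj t)) <=
  theta * (w l i * (circle_dist y z + `|s - t|)).
Proof.
have shift_lt x r : circle_dist (p l i) x + `|r| < rho ->
    circle_dist (p l i) (x + proj r) < rho.
  apply: le_lt_trans; rewrite -[p l i]addr0 -proj0.
  apply: le_trans (circle_distD _ _ _ _) _.
  by rewrite proj0 addr0 sub0r normrN.
move=> /shift_lt ys /shift_lt zt; apply: le_trans (f_contract ys zt) _.
by rewrite ler_wpM2l// ler_wpM2l// circle_distD.
Qed.

(** [u] and [v] stand for values of [h] or for its averages over measures, so one estimate serves
    both point orbits and push-forwards. The radius [2 * b] admits points within [b] of an orbit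
    that is itself within [b] of [p]. *)
Lemma coupled_contract l i y z (u v : 'I_N -> R) (e : R) :
  w l i * circle_dist (p l i) y <= 2 * b ->
  w l i * circle_dist (p l i) z <= 2 * b ->
  (forall j, `|u j| <= M) -> (forall j, `|v j| <= M) ->
  w l i * circle_dist y z <= e ->
  (forall j, `|u j - v j| <= L * (circle_dist y z + e / c)) ->
  w l.+1 i * circle_dist (f i (y + proj (\sum_j alpha i j * u j)))
                         (f i (z + proj (\sum_j alpha i j * v j))) <=
  Lambda * e.
Proof.
move=> py pz uM vM yze uvL.
have e0 : 0 <= e by apply: le_trans yze; rewrite mulr_ge0// circle_dist_ge0.
have in_rho x r : w l i * circle_dist (p l i) x <= 2 * b ->
    (forall j, `|r j| <= M) ->
    circle_dist (p l i) x + `|\sum_j alpha i j * r j| < rho.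
  move=> /dist_le_c px /(coupling_le i) rM.
  by apply: le_lt_trans box_lt_rho; exact: lerD.
apply: le_trans (shifted_contract (in_rho _ _ py uM) (in_rho _ _ pz vM)) _.
have yzc := dist_le_c yze.
have uv : `|\sum_j alpha i j * u j - \sum_j alpha i j * v j| <=
    eps * N%:R * (L * (2 / c)) * e.
  have -> : eps * N%:R * (L * (2 / c)) * e = eps * N%:R * (L * (e / c + e / c)).
    by ring.
  apply: coupling_dist_le => j; apply: le_trans (uvL j) _.
  by rewrite ler_wpM2l// lerD2r.
apply: le_trans (ler_wpM2r e0 Lambda_gt).
rewrite -[leRHS]mulrA ler_wpM2l// mulrDr mulrDl mul1r lerD//.
rewrite -[W * _ * e]mulrA; have /andP[_ wW] := w_bounds l i.
by rewrite ler_pM.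
Qed.

Definition in_box l (y : torus R N) :=
  forall i, w l i * circle_dist (p l i) (y 0 i) <= b.

Let in_box2 l y i : in_box l y -> w l i * circle_dist (p l i) (y 0 i) <= 2 * b.
Proof. by move=> /(_ i) yb; apply: le_trans yb _; rewrite ler_peMl ?ler1n// ltW. Qed.

(** Compares the coupled image of [y] with the uncoupled image of [p l], seen as a shift by 0; the
    coupling adds at most [eps * N * M] before contraction by [theta]. *)
Lemma in_box_coupled l y : in_box l y -> in_box l.+1 (G y).
Proof.
move=> yb i; rewrite mxE p_orbit -[p l i]addr0 -proj0.
have S_ge0 : 0 <= eps * N%:R * M by rewrite !mulr_ge0.
have hM := coupling_le i (fun j => h_bound i j (y 0 i) (y 0 j)).
have b2 := dist_le_c (in_box2 i yb).
have b20 : 0 <= 2 * b / c by rewrite divr_ge0 ?mulr_ge0 ?ltW.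
apply: le_trans (shifted_contract _ _) _.
- by rewrite circle_distxx normr0 addr0; apply: le_lt_trans box_lt_rho; exact: addr_ge0.
- by apply: le_lt_trans box_lt_rho; exact: lerD.
apply: le_trans box_stable; rewrite ler_wpM2l// mulrDr lerD//.
rewrite sub0r normrN; have /andP[_ wW] := w_bounds l i.
by rewrite ler_pM.
Qed.

Lemma in_box_iter l y n : in_box l y -> in_box (l + n) (iter n G y).
Proof.
by move=> yb; elim: n => [|n IH]; rewrite ?addn0// addnS; exact: in_box_coupled.
Qed.

Lemma coupled_map_contract l y z e : in_box l y -> in_box l z ->
  (forall i, w l i * circle_dist (y 0 i) (z 0 i) <= e) ->
  forall i, w l.+1 i * circle_dist (G y 0 i) (G z 0 i) <= Lambda * e.
Proof.
move=> yb zb yz i; rewrite !mxE; apply: coupled_contract => //; try exact: in_box2.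
move=> j; apply: le_trans (h_lip _ _ _ _ _ _) _.
by rewrite ler_wpM2l// lerD2l; apply: dist_le_c (yz j).
Qed.

Lemma iter_coupled_map_contract l y z e n : in_box l y -> in_box l z ->
  (forall i, w l i * circle_dist (y 0 i) (z 0 i) <= e) ->
  forall i, w (l + n)%N i * circle_dist (iter n G y 0 i) (iter n G z 0 i) <=
    Lambda ^+ n * e.
Proof.
move=> yb zb yz; elim: n => [|n IH] i; first by rewrite addn0 mul1r.
by rewrite addnS exprS -mulrA; apply: coupled_map_contract => //; exact: in_box_iter.
Qed.

(** * The periodic point of the coupled map *)

Section periodic_point.
Variable k : nat.
Hypothesis k_gt0 : (0 < k)%N.
Hypothesis p_periodic : forall l i, p (l + k)%N i = p l i.
Hypothesis w_periodic : forall l i, w (l + k)%N i = w l i.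

Let p_mul n i : p (n * k)%N i = p 0%N i.
Proof. by elim: n => // n IH; rewrite mulSn addnC p_periodic. Qed.

Let w_mul n i : w (n * k)%N i = w 0%N i.
Proof. by elim: n => // n IH; rewrite mulSn addnC w_periodic. Qed.

Let box_mul n y : in_box (n * k)%N y <-> in_box 0 y.
Proof. by split=> yb i; have := yb i; rewrite p_mul w_mul. Qed.

(** Contraction principle: [k] steps map the box at time 0 into itself and contract by
    [Lambda ^+ k], so the iterates of the uncoupled periodic point converge in each coordinate to a
    fixed point. *)
Lemma coupled_periodic_point : exists2 x, in_box 0 x & iter k G x = x.
Proof.
have /andP[La0 La1] := Lambda_itv.
pose u n := iter (n * k) G (\row_i p 0%N i).
have u0b : in_box 0 (u 0%N) by move=> i; rewrite mxE circle_distxx mulr0 ltW.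
have ub n : in_box 0 (u n) by apply/(box_mul n); exact: (in_box_iter (n * k) u0b).
have uS n : u n.+1 = iter (n * k) G (u 1%N).
  by rewrite /u -iterD mulSn mul1n addnC.
have u01 i : w 0%N i * circle_dist (u 0%N 0 i) (u 1%N 0 i) <= b.
  by rewrite {1}/u/= mxE; exact: ub.
have Lk : 0 <= Lambda ^+ k < 1.
  by rewrite exprn_ge0 ?ltW//= exprn_ilt1 ?ltW -?lt0n.
have ucauchy i n : circle_dist (u n 0 i) (u n.+1 0 i) <= b / c * (Lambda ^+ k) ^+ n.
  have := iter_coupled_map_contract (n * k) (ub 0%N) (ub 1%N) u01 i.
  have -> : Lambda ^+ (n * k) = (Lambda ^+ k) ^+ n by rewrite mulnC exprM.
  rewrite -uS -[iter _ _ (u 0%N)]/(u n) => /dist_le_c /le_trans; apply.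
  by rewrite [leRHS]mulrC mulrA.
have /choice[x xl] : forall i, exists l, forall e, 0 < e -> exists n0,
    forall n, (n0 <= n)%N -> circle_dist (u n 0 i) l < e.
  by move=> i; apply: circle_geometric_limit Lk (ucauchy i).
have ux e : 0 < e -> exists n0, forall n, (n0 <= n)%N ->
    forall i, w 0%N i * circle_dist (u n 0 i) (x i) <= e.
  move=> e0; have /choice[m mP] : forall i, exists n0, forall n, (n0 <= n)%N ->
      circle_dist (u n 0 i) (x i) < e / w 0%N i.
    by move=> i; apply: xl; rewrite divr_gt0.
  exists (\max_i m i) => n mn i; rewrite -ler_pdivlMl// mulrC ltW//.
  by apply: mP; apply: leq_trans mn; exact: leq_bigmax.
(* The limit stays in the box because the box is closed. *)
have xb : in_box 0 (\row_i x i).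
  move=> i; rewrite mxE; apply/ler_addgt0Pr => e e0.
  have [n0 /(_ _ (leqnn _))/(_ i) h1] := ux _ e0.
  apply: le_trans (ler_wpM2l (w_ge0 _ _) (circle_dist_triangle (u n0 0 i) _ _)) _.
  by rewrite mulrDr lerD//; exact: ub.
exists (\row_i x i) => //; apply/rowP => i; apply: circle_dist_eq0.
(* The limit and its image are both within [e / 2] of [u n0.+1], for arbitrary [e]. *)
rewrite -(pmulr_rle0 _ (w_gt0 0 i)); apply/ler_addgt0Pr => e e0; rewrite add0r.
have e20 : 0 < e / 2 by rewrite divr_gt0.
have [n0 n0P] := ux _ e20.
apply: le_trans (ler_wpM2l (w_ge0 _ _) (circle_dist_triangle (u n0.+1 0 i) _ _)) _.
rewrite mulrDr [leRHS]splitr lerD//; last by rewrite mxE; exact: n0P.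
have un0 j : w 0%N j * circle_dist ((\row_i x i) 0 j) (u n0 0 j) <= e / 2.
  by rewrite mxE circle_distC; exact: n0P.
have := iter_coupled_map_contract k xb (ub n0) un0 i.
rewrite add0n -[k in w k]add0n w_periodic.
have -> : iter k G (u n0) = u n0.+1 by rewrite /u -iterD mulSn.
move=> /le_trans; apply; apply: ler_piMl; first exact: ltW.
by have /andP[_ /ltW] := Lk.
Qed.

End periodic_point.

(** * Measures carried near the periodic orbit *)

Section measures.
Hypothesis f_cont : forall i, circle_cont (f i).
(** The measures are carried by sets [K i] close to the orbit of [x] at time [l], which records the
    phase at which they start. *)
Variables (mu : 'I_N -> probability (circle R) R) (x : torus R N) (l : nat)
          (K : 'I_N -> set (circle R)).
Hypothesis x_box : in_box 0 x.
Hypothesis K_measurable : forall i, measurable (K i).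
Hypothesis K_full : forall i, mu i (K i) = 1%E.
Hypothesis K_close : forall i z, K i z ->
  w l i * circle_dist (iter l G x 0 i) z <= b.

Local Notation F := (self_consistent_op f h alpha).
Local Notation mu_ n := (iter n F (fun i => mu i)).

Let h_measurable i j y : measurable_fun setT (h i j y).
Proof.
apply: (@circle_lip_measurable _ _ L) => z z'.
by apply: le_trans (h_lip i j y z y z') _; rewrite circle_distxx add0r.
Qed.

(** Provides the measurability of the maps that push the measures forward: the argument of [f i] is
    Lipschitz with constant [1 + eps * N * Q]. *)
Lemma mean_field_map_cont (nu : 'I_N -> set_function R) (Q : R) :
  0 <= Q ->
  (forall i j y z, `|fine (\int[nu j]_t (h i j y t)%:E)%E -
                    fine (\int[nu j]_t (h i j z t)%:E)%E| <= Q * circle_dist y z) ->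
  forall i, circle_cont (mean_field_map f h alpha nu i).
Proof.
move=> Q0 nuQ i y e e0.
have [r r0 fr] := f_cont i (y + proj (\sum_j alpha i j *
  fine (\int[nu j]_t (h i j y t)%:E)%E)) e0.
have q0 : 0 < 1 + eps * N%:R * Q.
  by rewrite ltr_wpDr// !mulr_ge0.
exists (r / (1 + eps * N%:R * Q)); first by rewrite divr_gt0.
move=> z; rewrite ltr_pdivlMr// => yz; apply: fr.
apply: le_lt_trans (circle_distD _ _ _ _) _; apply: le_lt_trans yz.
rewrite mulrDr mulr1 lerD2l [leRHS]mulrC -[leRHS]mulrA.
by apply: coupling_dist_le => j; exact: nuQ.
Qed.

(** Induction on [n]: the next [Phi] is the mean-field map of the current measures after the current
    [Phi]. Its distance to the orbit contracts by [coupled_contract]. *)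
Lemma self_consistent_op_pushforward n : exists Phi : 'I_N -> circle R -> circle R,
  [/\ forall i, measurable_fun setT (Phi i),
      mu_ n = (fun i => pushforward (mu i) (Phi i)) &
      forall i z, K i z ->
        w (l + n)%N i * circle_dist (Phi i z) (iter (l + n) G x 0 i) <=
        Lambda ^+ n * b].
Proof.
have /andP[La0 La1] := Lambda_itv.
elim: n => [|n [Phi [mPhi muE PhiK]]].
  exists (fun i => id); split=> // i z /K_close.
  by rewrite addn0 expr0 mul1r circle_distC.
(* The averaged interaction at time [n]. Rewritten over the initial measure through [Phi], it
   inherits the bounds on [h]. *)
pose E i j y := fine (\int[mu_ n j]_t (h i j y t)%:E)%E.
have EE i j y : E i j y = fine (\int[mu j]_z (h i j y (Phi j z))%:E)%E.
  rewrite /E muE; congr fine.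
  exact: (integral_pushforward_bounded _ (mPhi j) (h_measurable i j y) (h_bound i j y)).
have mh i j y : measurable_fun setT (fun z => h i j y (Phi j z)).
  exact: measurableT_comp (h_measurable i j y) (mPhi j).
have E_lip i j y z : `|E i j y - E i j z| <= L * circle_dist y z.
  rewrite !EE; apply: (Rintegral_close measurableT (probability_setT _)
    (mh i j y) (mh i j z)) => t; [exact: h_bound..|move=> _].
  by apply: le_trans (h_lip _ _ _ _ _ _) _; rewrite circle_distxx addr0.
have E_bound i j y : `|E i j y| <= M.
  rewrite -[E i j y]subr0 EE; apply: (Rintegral_close_cst measurableT
    (probability_setT _) (mh i j y)) => t; first exact: h_bound.
  by move=> _; rewrite subr0.
have mF i : measurable_fun setT (mean_field_map f h alpha (mu_ n) i).
  apply: circle_cont_measurable; exact: (mean_field_map_cont L_ge0 E_lip).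
exists (fun i => mean_field_map f h alpha (mu_ n) i \o Phi i); split.
- by move=> i; exact: measurableT_comp.
- rewrite iterS {1}/self_consistent_op; apply/funext => i.
  by rewrite {1}muE.
move=> i z Kz; have x_box' : in_box (l + n) (iter (l + n) G x).
  by rewrite -[X in in_box X]add0n; exact: in_box_iter.
have close := PhiK i z Kz.
rewrite addnS [iter _.+1 _ x]iterS mxE exprS -mulrA.
apply: coupled_contract => //.
(* The pushed point is within [b] of the orbit of [x], which is within [b] of [p]. *)
- apply: le_trans (ler_wpM2l (w_ge0 _ _)
    (circle_dist_triangle (iter (l + n) G x 0 i) _ _)) _.
  rewrite mulrDr mulr_natl mulr2n lerD//.
  rewrite circle_distC; apply: le_trans close _.
  by apply: ler_piMl; [exact: ltW|apply: exprn_ile1; exact: ltW].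
- exact: in_box2.
- by move=> j; exact: E_bound.
(* An average is compared with the single value at the orbit point: on the full-measure set [K j],
   [Phi j] is close to the [j]-th coordinate of the orbit. *)
move=> j; rewrite -/(E i j (Phi i z)) EE.
apply: (Rintegral_close_cst (K_measurable j) (K_full j) (mh i j _)) => t.
  exact: h_bound.
move=> Kt; apply: le_trans (h_lip _ _ _ _ _ _) _.
by rewrite ler_wpM2l// lerD2l; exact: dist_le_c (PhiK j t Kt).
Qed.

Lemma wasserstein_orbit_le n :
  (wasserstein_max (mu_ n) (fun i => \d_(iter (l + n) G x 0%R i)) <=
   (b / c * Lambda ^+ n)%:E)%E.
Proof.
have /andP[La0 La1] := Lambda_itv.
have [Phi [mPhi -> PhiK]] := self_consistent_op_pushforward n.
apply: bigmax_le => [|i _].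
  by rewrite lee_fin mulr_ge0 ?divr_ge0 ?exprn_ge0 ?ltW.
apply: (wasserstein_pushforward_dirac (K_measurable i) (K_full i) (mPhi i)) => z.
by move=> /PhiK /dist_le_c /le_trans; apply; rewrite mulrAC mulrC mulrA mulrAC.
Qed.

End measures.
End coupled_dynamics.

(** * Supports and their diameter *)

Section supports.
Variables (R : realType) (mu : probability (circle R) R).

Lemma msupport_nonempty : exists x, msupport mu x.
Proof.
apply: contrapT => /forallNP H.
have : mu set0 = 1%E.
  by apply: probability_support => [|x /H//]; rewrite setC0; exact: openT.
by rewrite measure0 => /eqP; rewrite eq_sym onee_eq0.
Qed.

Lemma msupport_dist_le (delta : R) x y : support_length mu < delta ->
  msupport mu x -> msupport mu y -> circle_dist x y <= delta.
Proof.
move=> /inf_lt[|e [/andP[e0 _] [a mua]] ed].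
  (* The set of admissible lengths is nonempty, as an arc of length 1 is the whole circle. *)
  exists 1; split; first by rewrite ler01 lexx.
  exists 0 => z _; have [t <- t01] := circle_rep01 z.
  by exists t => //; rewrite /= in_itv/= add0r.
move=> /mua[s + <-] /mua[t + <-]; rewrite /= !in_itv/= => /andP[s1 s2] /andP[t1 t2].
apply: le_trans (circle_dist_proj _ _) _; apply: le_trans (ltW ed).
by rewrite ler_norml; apply/andP; split; lra.
Qed.

End supports.

Lemma circle_class_C2_cont (R : realType) (f : circle R -> circle R) :
  circle_class_C 2 f -> circle_cont f.
Proof.
move=> cf x e e0; have [D _ /(_ 1 ltr01)[r r0 fr]] := circle_class_C2_deriv x cf.
have D1 : 0 < `|D| + 1 by rewrite ltr_wpDl.
exists (Num.min r (e / (`|D| + 1))); first by rewrite lt_min r0 divr_gt0.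
move=> y; rewrite lt_min ltr_pdivlMr// => /andP[yr ye].
by apply: le_lt_trans (fr _ _ _ yr) _; rewrite ?circle_distxx// mulrC.
Qed.

(** * Attracting periodic orbits under weak coupling *)

Theorem proposition3p1 (R : realType) (N : nat)
    (f : 'I_N -> circle R -> circle R)
    (h : 'I_N -> 'I_N -> circle R -> circle R -> R)
    (k : nat) (x : torus R N)
    (hf : forall i, circle_class_C 2 (f i))
    (hh : forall i j, circle2_class_C 2 (h i j))
    (hx : attracting_periodic k (product_map f) x) :
  exists2 eps : R, 0 < eps &
  forall alpha : 'M[R]_N, (forall i j, `|alpha i j| < eps) ->
  exists2 x_a : torus R N, iter k (coupled_map f h alpha) x_a = x_a &
  let X_a := [set iter l (coupled_map f h alpha) x_a | l in `I_k] in
  exists r delta Lambda : R,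
    [/\ 0 < r, 0 < delta, 0 < Lambda < 1 &
      forall mu : 'I_N -> probability (circle R) R,
        support_size mu < delta ->
        support_prod mu `<=` torus_nbhd r X_a ->
        exists2 C : R, 0 < C &
        forall n : nat,
          (wasserstein_set
             (iter n (self_consistent_op f h alpha) (fun i => mu i))
             (dirac_tuples X_a) <= (C * Lambda ^+ n)%:E)%E].
Proof.
case: hx => k0 xk [lam /andP[lam0 lam1] [A dA Alam]].
have /choice[D HD] : forall q : 'I_N * circle R, exists D,
    circle_deriv (f q.1) q.2 D /\
    forall e, 0 < e -> exists2 r, 0 < r & forall y z,
      circle_dist q.2 y < r -> circle_dist q.2 z < r ->
      circle_dist (f q.1 y) (f q.1 z) <= (`|D| + e) * circle_dist y z.
  by move=> [i y]; have [D ? ?] := circle_class_C2_deriv y (hf i); exists D.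
pose p l i := iter l (f i) (x 0 i).
have p_per l i : p (l + k)%N i = p l i.
  by rewrite /p iterD -iter_product_map xk.
have p_orbit l i : p l.+1 i = f i (p l i) by [].
pose a i l := `|D (i, p l i)|.
(* By the chain rule and uniqueness, this product is the modulus of the derivative of the [i]-th
   coordinate of the [k]-th iterate, at most [lam]. *)
have a_prod i : \prod_(l < k) a i l < 1.
  have [D' fD' D'lam] := torus_diff_coord (fun y => iter_product_map f k y i) dA Alam.
  have fD := circle_deriv_iter (x 0 i) (fun y => (HD (i, y)).1) k.
  rewrite /a -normr_prod.
  by rewrite -(circle_deriv_unique fD' fD) (le_lt_trans D'lam).
(* For each coordinate: a margin on the derivatives, a contraction factor and the periodic
   weights. *)
have /choice[ew ewP] : forall i, exists t : R * R * (nat -> R),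
    [/\ 0 < t.1.1, 0 < t.1.2 < 1, forall l, 0 < t.2 l,
      forall l, t.2 (l + k)%N = t.2 l &
      forall l, t.2 l.+1 * (a i l + t.1.1) <= t.1.2 * t.2 l].
  move=> i; have [||e [th [w H]]] := @cyclic_weights _ (a i) k k0 _ _ (a_prod i).
  - by move=> l; exact: normr_ge0.
  - by move=> l; rewrite /a p_per.
  by exists (e, th, w).
have /choice[r HrP] : forall q : 'I_N * 'I_k, exists r, 0 < r /\ forall y z,
    circle_dist (p q.2 q.1) y < r -> circle_dist (p q.2 q.1) z < r ->
    circle_dist (f q.1 y) (f q.1 z) <= (a q.1 q.2 + (ew q.1).1.1) * circle_dist y z.
  move=> [i l]; have [e0 _ _ _ _] := ewP i.
  by have [r r0 Hr] := (HD (i, p l i)).2 _ e0; exists r.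
have [rho rho0 rho_le] := fin_lower_bound (fun q => (HrP q).1).
have [m m0 m_le] : exists2 m, 0 < m & forall i, m <= 1 - (ew i).1.2.
  by apply: fin_lower_bound => i; have [_ /andP[_ ?] _ _ _] := ewP i; rewrite subr_gt0.
(* A common contraction factor for all coordinates. The cap 1/2 keeps it nonnegative, also for
   [N = 0], where nothing bounds [m] from above. *)
pose theta := 1 - Num.min m 2^-1.
have m20 : 0 < Num.min m 2^-1 by rewrite lt_min m0 invr_gt0 ltr0n.
have theta0 : 0 <= theta by rewrite subr_ge0 ge_min invf_le1// ler1n orbT.
have theta1 : theta < 1 by rewrite gtrBl.
have theta_le i : (ew i).1.2 <= theta.
  by rewrite lerBrDl -lerBrDr ge_min m_le.
pose w l i := (ew i).2 l.
have w0 l i : 0 < w l i by have [_ _ H _ _] := ewP i; exact: H.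
have w_per l i : w (l + k)%N i = w l i by have [_ _ _ H _] := ewP i; exact: H.
have w_mod l i : w l i = w (l %% k)%N i.
  exact: (periodic_modn (fun l => w_per l i)).
have p_mod l i : p l i = p (l %% k)%N i.
  exact: (periodic_modn (fun l => p_per l i)).
have [c c0 c_le] : exists2 c, 0 < c & forall q : 'I_N * 'I_k, c <= w q.2 q.1.
  exact: fin_lower_bound.
have [W W0 W_le] : exists2 W, 0 < W & forall q : 'I_N * 'I_k, w q.2 q.1 <= W.
  exact: fin_upper_bound.
have w_bounds l i : c <= w l i <= W.
  have lk : (l %% k < k)%N by rewrite ltn_mod.
  by rewrite w_mod (c_le (i, Ordinal lk)) (W_le (i, Ordinal lk)).
have f_contract l i y z :
    circle_dist (p l i) y < rho -> circle_dist (p l i) z < rho ->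
    w l.+1 i * circle_dist (f i y) (f i z) <= theta * (w l i * circle_dist y z).
  have lk : (l %% k < k)%N by rewrite ltn_mod.
  have aE : a i (l %% k)%N = a i l by rewrite /a -p_mod.
  have [_ /(_ y z) H] := HrP (i, Ordinal lk).
  rewrite p_mod => py pz.
  have := H (lt_le_trans py (rho_le _)) (lt_le_trans pz (rho_le _)).
  rewrite /= aE => H1; apply: le_trans (ler_wpM2l (ltW (w0 _ _)) H1) _.
  rewrite mulrA [leRHS]mulrA ler_wpM2r ?circle_dist_ge0//.
  have [_ _ _ _ /(_ l) H2] := ewP i; apply: le_trans H2 _.
  by rewrite ler_wpM2r ?theta_le// ltW// w0.
have /choice[ML HML] : forall q : 'I_N * 'I_N, exists ML : R * R,
    [/\ 0 < ML.1, 0 < ML.2, forall x y, `|h q.1 q.2 x y| <= ML.1 &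
      forall x y x' y', `|h q.1 q.2 x y - h q.1 q.2 x' y'| <=
        ML.2 * (circle_dist x x' + circle_dist y y')].
  by move=> [i j]; have [M [L H]] := circle2_class_C2_lipschitz (hh i j); exists (M, L).
have [M M0 M_le] : exists2 M, 0 < M & forall q, (ML q).1 <= M.
  by apply: fin_upper_bound => q; have [] := HML q.
have [L L0 L_le] : exists2 L, 0 < L & forall q, (ML q).2 <= L.
  by apply: fin_upper_bound => q; have [] := HML q.
have h_bound i j y z : `|h i j y z| <= M.
  by have [_ _ + _] := HML (i, j) => /(_ y z)/le_trans; apply.
have h_lip i j y z y' z' :
    `|h i j y z - h i j y' z'| <= L * (circle_dist y y' + circle_dist z z').
  have [_ _ _ /(_ y z y' z')/le_trans] := HML (i, j); apply.
  by rewrite ler_wpM2r// addr_ge0// circle_dist_ge0.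
(* Then [2 * b / c] is [rho / 2], which leaves room for the coupling shift. *)
pose b := c * rho / 4.
have b0 : 0 < b by rewrite divr_gt0// mulr_gt0.
have N0 : 0 <= N%:R :> R by [].
pose X1 := N%:R * M; pose X2 := W * (N%:R * M); pose X3 := W * (N%:R * (L * (2 / c))).
have X10 : 0 <= X1 by apply: mulr_ge0 => //; exact: ltW.
have X20 : 0 <= X2 by apply: mulr_ge0 => //; exact: ltW.
have X30 : 0 <= X3.
  by apply: mulr_ge0; rewrite ?mulr_ge0// ?invr_ge0 ltW.
have X0 : 0 < 1 + X1 + X2 + X3 by lra.
(* The coupling budget. Its three terms serve, in order, [box_lt_rho], [box_stable] and [Lambda_gt],
   and the denominator of [eps] keeps each coupling term within it. *)
pose kappa := Num.min (rho / 4) (Num.min ((1 - theta) * b) ((1 - theta) / 2)).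
have t1 : 0 < 1 - theta by rewrite subr_gt0.
have kappa0 : 0 < kappa.
  by rewrite !lt_min !divr_gt0// mulr_gt0.
pose eps := kappa / (1 + X1 + X2 + X3).
have eps0 : 0 < eps by rewrite divr_gt0.
have eps_le (X : R) : X <= 1 + X1 + X2 + X3 -> eps * X <= kappa.
  by move=> XX; rewrite /eps mulrAC ler_pdivrMr//; apply: ler_wpM2l => //; exact: ltW.
have /andP[k1 /andP[k2 k3]] : [&& kappa <= rho / 4, kappa <= (1 - theta) * b
    & kappa <= (1 - theta) / 2].
  by rewrite /kappa !ge_min !lexx !orbT.
have e1 : eps * X1 <= kappa by apply: eps_le; lra.
have e2 : eps * X2 <= kappa by apply: eps_le; lra.
have e3 : eps * X3 <= kappa by apply: eps_le; lra.
have box_lt_rho : 2 * b / c + eps * N%:R * M < rho.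
  have -> : 2 * b / c = rho / 2 by rewrite /b; field; rewrite gt_eqF.
  by rewrite -mulrA -/X1; lra.
have box_stable : theta * (b + W * (eps * N%:R * M)) <= b.
  have -> : W * (eps * N%:R * M) = eps * X2 by rewrite /X2; ring.
  have e20 : 0 <= eps * X2 by rewrite mulr_ge0// ltW.
  rewrite mulrDr; have : theta * (eps * X2) <= eps * X2 by rewrite ler_piMl// ltW.
  by move: (theta * (eps * X2)) => Y; lra.
pose Lambda := (1 + theta) / 2.
have Lambda01 : 0 < Lambda < 1 by rewrite /Lambda; apply/andP; split; lra.
have Lambda_gt : theta * (1 + W * (eps * N%:R * (L * (2 / c)))) <= Lambda.
  have -> : W * (eps * N%:R * (L * (2 / c))) = eps * X3 by rewrite /X3; ring.
  have e30 : 0 <= eps * X3 by rewrite mulr_ge0// ltW.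
  rewrite mulrDr; have : theta * (eps * X3) <= eps * X3 by rewrite ler_piMl// ltW.
  by move: (theta * (eps * X3)) => Y; rewrite /Lambda; lra.
exists eps => // alpha alpha_lt.
have alpha_le i j : `|alpha i j| <= eps by exact: ltW.
have [x_a x_box xak] := coupled_periodic_point c0 w_bounds
  p_orbit theta0 f_contract h_bound (ltW L0) h_lip (ltW eps0) alpha_le
  b0 (ltW M0) box_lt_rho box_stable Lambda_gt Lambda01 k0 p_per w_per.
exists x_a => //; set G := coupled_map f h alpha.
set X_a := (X in let _ := X in _); rewrite /=.
(* Serves as both [r] and [delta]: a point within [2 * d] of the orbit is within weighted distance
   [b]. *)
pose d := b / (2 * W).
have d0 : 0 < d by rewrite divr_gt0// mulr_gt0.
exists d, d, Lambda; split=> // mu mu_size mu_near.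
have /choice[y0 y0P] : forall i, exists y, msupport (mu i) y.
  by move=> i; exact: msupport_nonempty.
(* One point of the product support selects the phase [l]. *)
have : torus_nbhd d X_a (\row_i y0 i) by apply: mu_near => i; rewrite mxE.
move=> /ereal_inf_lt[_ [_ [l lk <-] <-]]; rewrite lte_fin => y0l.
(* One [d] is the distance from [y0] to the orbit point, the other bounds the diameter of the
   support. *)
pose K i := [set z | circle_dist (iter l G x_a 0 i) z <= d + d].
have K_full i : mu i (K i) = 1%E.
  apply: probability_support.
    rewrite (_ : ~` K i = [set z | d + d < circle_dist (iter l G x_a 0 i) z]).
      exact: open_circle_ballC.
    by apply/seteqP; split => z /=; rewrite ltNge => /negP.
  move=> z muz; apply: le_trans (circle_dist_triangle (y0 i) _ _) _.
  apply: lerD.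
    rewrite circle_distC; apply: le_trans (ltW y0l).
    have := @le_bigmax _ _ _ 0 (fun j => circle_dist ((\row_i y0 i) 0 j) (iter l G x_a 0 j)) i.
    by rewrite mxE.
  apply: (msupport_dist_le _ (y0P i) muz); apply: le_lt_trans mu_size.
  exact: (le_bigmax _ (fun j => support_length (mu j)) i).
have K_close i z : K i z -> w l i * circle_dist (iter l G x_a 0 i) z <= b.
  move=> Kz; have /andP[_ wW] := w_bounds l i.
  have -> : b = W * (d + d) by rewrite /d; field; rewrite gt_eqF.
  by rewrite ler_pM ?circle_dist_ge0// ltW.
exists (b / c) => [|n]; first by rewrite divr_gt0.
apply: ge_ereal_inf.
exists (wasserstein_max (iter n (self_consistent_op f h alpha) (fun i => mu i))
  (fun i => \d_(iter (l + n) G x_a 0 i))).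
  exists (fun i => [the probability (circle R) R of \d_(iter (l + n) G x_a 0 i)]) => //.
  (* By periodicity the orbit point at time [l + n] belongs to [X_a]. *)
  exists (iter (l + n) G x_a) => //; exists ((l + n) %% k)%N; first by rewrite /= ltn_mod.
  rewrite -(periodic_modn (a := fun j => iter j G x_a))// => j.
  by rewrite iterD xak.
exact: (wasserstein_orbit_le c0 w_bounds
  p_orbit theta0 f_contract h_bound (ltW L0) h_lip (ltW eps0) alpha_le
  b0 (ltW M0) box_lt_rho box_stable Lambda_gt Lambda01
  (fun i => circle_class_C2_cont (hf i)) x_box
  (fun i => measurable_circle_cball _ _) K_full K_close).
Qed.
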